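(* Every arithmetic progression contains infinitely many Lucas-Niven numbers. That is, for all positive integers $a,d$, the arithmetic progression $(a+kd)_{k=0}^\infty$ contains infinitely many Lucas-Niven numbers.
   Context: Let $\mathbb{N}$ be the set of positive integers and let $L_i$ be the Lucas numbers: $L_0=2$, $L_1=1$, $L_i=L_{i-1}+L_{i-2}$ for $i\ge 2$. By a theorem of Brown, every $n\in\mathbb{N}$ has a unique sequence $(\lambda_i(n))_{i=0}^\infty$ with $\lambda_i(n)\in\{0,1\}$ and $\lambda_i(n)+\lambda_{i+1}(n)\le 1$ for all $i\ge 0$, and $\lambda_0(n)+\lambda_2(n)\le 1$, such that $n=\sum_{i=0}^\infty\lambda_i(n)L_i$ (the Lucas decomposition of $n$). Put $s_L(n)=\sum_{i=0}^\infty\lambda_i(n)$. A positive integer $n$ is called Lucas-Niven if $s_L(n)$ divides $n$. An arithmetic progression is an infinite sequence of positive integers $(a+kd)_{k=0}^\infty$ with $a,d\in\mathbb{N}$. *)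

(* Defs.v *)
From mathcomp Require Import all_boot zify.

Set Implicit Arguments.
Unset Strict Implicit.
Unset Printing Implicit Defensive.

Fixpoint lucas (n : nat) : nat :=
  match n with
  | 0 => 2
  | 1 => 1
  | (m.+1 as p).+1 => lucas p + lucas m
  end.

(* A [bool] digit is coerced to the natural number 0 or 1; the constraint
   lambda_i + lambda_j <= 1 reads [~~ (lam i && lam j)]. *)
Definition lucas_admissible (lam : nat -> bool) : Prop :=
  (forall i, ~~ (lam i && lam i.+1)) /\ ~~ (lam 0 && lam 2).

(* Since every Lucas number is positive, the infinite sum is finite exactly when
   the digits vanish from some rank [N] on. *)
Definition lucas_decomposition (n : nat) (lam : nat -> bool) : Prop :=
  lucas_admissible lam /\
  exists N, (forall i, N <= i -> lam i = false) /\
            n = \sum_(i < N) lam i * lucas i.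

Lemma lucasSS n : lucas n.+2 = lucas n.+1 + lucas n.
Proof. by []. Qed.

Arguments lucas : simpl never.

Lemma lucas_gt0 n : 0 < lucas n.
Proof.
suff: (0 < lucas n) && (0 < lucas n.+1) by case/andP.
by elim: n => [//|n /andP[h1 h2]]; rewrite h2 lucasSS ltn_addr.
Qed.

Lemma leq_lucas n : n <= lucas n.
Proof.
case: n => [//|n]; elim: n => [//|n IH].
by rewrite lucasSS -addn1 leq_add ?lucas_gt0.
Qed.

Lemma lucas_decomposition_sum n lam : lucas_decomposition n lam ->
  exists N, forall M, N <= M -> \sum_(i < M) lam i * lucas i = n.
Proof.
move=> [_ [N [h0 ->]]]; exists N; elim=> [|M IH] leNM.
  by have -> : N = 0 by lia.
have [leM|ltMN] := leqP N M; last by have -> : N = M.+1 by lia.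
by rewrite big_ord_recr /= h0 // addn0 IH.
Qed.

Lemma lucas_admissible_lt lam k : lucas_admissible lam ->
  \sum_(i < k.+2) lam i * lucas i < lucas k.+2.
Proof.
move=> [adj h02].
suff: (\sum_(i < k.+2) lam i * lucas i < lucas k.+2) &&
      (\sum_(i < k.+3) lam i * lucas i < lucas k.+3) by case/andP.
elim: k => [|k /andP[h1 h2]].
  rewrite !big_ord_recr !big_ord0 /=; move: (adj 0) (adj 1) h02.
  by case: (lam 0) (lam 1) (lam 2) => [] [] [].
rewrite h2 /= big_ord_recr /= lucasSS.
case E: (lam k.+3); last by rewrite addn0 ltn_addr.
have := adj k.+2; rewrite E andbT => /negbTE F.
by rewrite big_ord_recr /= F addn0 mul1n addnC ltn_add2l.
Qed.

(* Existence in Brown's theorem, as a [sig] so that the digits can be projected. *)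
Lemma lucas_decomposition_exists n : {lam | lucas_decomposition n lam}.
Proof.
suff H k : forall m, m < lucas k.+2 ->
    {lam : nat -> bool | lucas_admissible lam /\
      ((forall i, k.+2 <= i -> lam i = false) /\
       m = \sum_(i < k.+2) lam i * lucas i)}.
  have [|lam [h1 h2]] := H n n; first by have := leq_lucas n.+2; lia.
  by exists lam; split=> //; exists n.+2.
suff: ((forall m, m < lucas k.+2 ->
    {lam : nat -> bool | lucas_admissible lam /\
      ((forall i, k.+2 <= i -> lam i = false) /\
       m = \sum_(i < k.+2) lam i * lucas i)}) *
  (forall m, m < lucas k.+3 ->
    {lam : nat -> bool | lucas_admissible lam /\
      ((forall i, k.+3 <= i -> lam i = false) /\
       m = \sum_(i < k.+3) lam i * lucas i)}))%type by case.
elim: k => [|k [IH1 IH2]]; split=> // m.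
- case: m => [|[|[|//]]] _; [exists pred0|exists (pred1 1)|exists (pred1 0)];
    (do 2 split=> //); rewrite ?big_ord_recr ?big_ord0 //=; try by case=> [|[|]].
- case: m => [|[|[|[|//]]]] _;
    [exists pred0|exists (pred1 1)|exists (pred1 0)|exists (pred1 2)];
    (do 2 split=> //); rewrite ?big_ord_recr ?big_ord0 //=; try by case=> [|[|[|]]].
move=> ltm; have [ge|lt] := leqP (lucas k.+3) m; last first.
  have [lam [adm [h0 hm]]] := IH2 _ lt; exists lam; split=> //; split.
    by move=> i hi; apply: h0; lia.
  by rewrite big_ord_recr /= h0 // addn0.
have [|lam [[adj h02] [h0 hm]]] := IH1 (m - lucas k.+3).
  by move: ltm; rewrite (lucasSS k.+2); lia.
exists (fun i => (i == k.+3) || lam i); split; last split.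
- split=> [i|]; last by [].
  have [->|ne] /= := eqVneq i k.+3.
    by rewrite h0 ?orbF ?gtn_eqF //; lia.
  have [[->]|ne'] /= := eqVneq i.+1 k.+3; last exact: adj.
  by rewrite h0.
- by move=> i hi; rewrite h0 ?orbF ?gtn_eqF //; lia.
rewrite big_ord_recr big_ord_recr /= eqxx h0 // ltn_eqF // addn0 mul1n.
rewrite -[LHS](subnK ge) hm; congr (_ + _); apply: eq_bigr => j _.
by rewrite ltn_eqF //; have := ltn_ord j; lia.
Qed.

Lemma lucas_decomposition_unique n lam mu :
  lucas_decomposition n lam -> lucas_decomposition n mu -> lam =1 mu.
Proof.
move=> dl dm i; have [N hN] := lucas_decomposition_sum dl.
have [M hM] := lucas_decomposition_sum dm.
case: dl dm => [al _] [am _].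
pose K := N + M + i.
have : \sum_(j < K.+2) lam j * lucas j = \sum_(j < K.+2) mu j * lucas j.
  by rewrite hN ?hM // /K; lia.
have : i < K.+2 by rewrite /K; lia.
elim: K => [|k IH].
  rewrite !big_ord_recr !big_ord0 /=; move: (al.1 0) (am.1 0).
  case: i => [|[|//]] + + _;
    by case: (lam 0) (lam 1) (mu 0) (mu 1) => [] [] [] [].
rewrite big_ord_recr [in RHS]big_ord_recr /= => lti E.
have := lucas_admissible_lt k al; have := lucas_admissible_lt k am.
move: E IH.
set A := \sum_(_ < _) _; set B := \sum_(_ < _) _ => E IH ltB ltA.
have Ek : lam k.+2 = mu k.+2.
  by move: E; case: (lam k.+2) (mu k.+2) => [] [] //; rewrite ?mul1n ?mul0n; lia.
have [->//|ne] := eqVneq i k.+2.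
by apply: IH; [lia | move: E; rewrite Ek => /addIn].
Qed.

Definition lucas_digit (n : nat) : nat -> bool :=
  sval (lucas_decomposition_exists n).

Lemma lucas_digitP n : lucas_decomposition n (lucas_digit n).
Proof. exact: svalP. Qed.

Lemma lucas_digit_gt n i : n < i -> lucas_digit n i = false.
Proof.
move=> lt; apply/negbTE/negP => li.
have [N /(_ (N + i.+1))] := lucas_decomposition_sum (lucas_digitP n).
have hi : i < N + i.+1 by lia.
rewrite (bigD1 (Ordinal hi)) //= li mul1n => /(_ (leq_addr _ _)).
by have := leq_lucas i; lia.
Qed.

(* By [lucas_digit_gt] the digits of [n] of index greater than [n] are all 0. *)
Definition lucas_digit_sum (n : nat) : nat := \sum_(i < n.+1) lucas_digit n i.

Definition lucas_niven (n : nat) : bool := (0 < n) && (lucas_digit_sum n %| n).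

(* Main.v *)
(* Modulo [a * d] the Lucas sequence is purely periodic, so infinitely many
   Lucas numbers are congruent to [lucas 1 = 1].  A sum [n] of [a] of them with
   non-adjacent indices has digit sum [a] and satisfies [n = a %[mod a * d]],
   so that [a] divides [n] and [n] lies in the progression. *)

Require Import Defs.
From mathcomp Require Import all_boot all_classical.
From mathcomp Require Import zify.

Local Open Scope classical_set_scope.

(** Two consecutive residues determine the whole sequence in both directions, and there are only
    [m * m] pairs of residues; hence some pair recurs and the period has no preperiod. *)
Lemma lucas_periodic (m : nat) : (0 < m)%N ->
  exists2 P, (0 < P)%N & forall i, lucas (i + P) = lucas i %[mod m].
Proof.
case: m => // m _; set M := m.+1.
pose f (i : 'I_(M * M).+1) : 'I_M * 'I_M :=
  (inord (lucas i %% M), inord (lucas i.+1 %% M)).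
have /injectivePn[i [j nij Ef]] : ~~ injectiveb f.
  apply/negP => /injectiveP/leq_card.
  by rewrite card_prod !card_ord ltnn.
have {Ef} [E0 E1] : lucas i = lucas j %[mod M] /\
    lucas i.+1 = lucas j.+1 %[mod M].
  case: Ef => /(congr1 val) + /(congr1 val).
  by rewrite /= !inordK ?ltn_pmod.
wlog ltij : i j nij E0 E1 / (i < j)%N.
  move=> W; case: (ltngtP i j) => [lt|lt|/val_inj E].
  - exact: (W i j).
  - by apply: (W j i) => //; rewrite eq_sym.
  - by rewrite E eqxx in nij.
exists (j - i)%N; first by rewrite subn_gt0.
(* The recurrence run backwards, [lucas k] being [lucas k.+2] minus [lucas k.+1], carries the
   coincidence from [i] and [j] down to 0 and [j - i]. *)
have {E0 E1} [E0 E1] : lucas (j - i) = lucas 0 %[mod M] /\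
    lucas (j - i).+1 = lucas 1 %[mod M].
  move: E0 E1; rewrite -{1 2}(subnKC (ltnW ltij)).
  elim: (i : nat) (j - i)%N => [//|k IH] p E0 E1; apply: IH => //.
  apply/eqP; rewrite -(eqn_modDl (lucas k.+1)) -lucasSS E1.
  by rewrite !addSn lucasSS eqn_modDr -addSn E0.
suff H k : lucas (k + (j - i)) = lucas k %[mod M] /\
    lucas (k + (j - i)).+1 = lucas k.+1 %[mod M] by move=> k; case: (H k).
elim: k => [//|k [IH0 IH1]]; split=> //.
by rewrite !addSn !lucasSS -modnDm IH0 IH1 modnDm.
Qed.

Lemma sum_mem_seq (s : seq nat) (F : nat -> nat) (N : nat) :
  uniq s -> (forall i, i \in s -> (i < N)%N) ->
  \sum_(i < N) (nat_of_ord i \in s) * F i = \sum_(i <- s) F i.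
Proof.
move=> us hs; rewrite -(big_mkord xpredT (fun i => (i \in s) * F i)%N).
rewrite (eq_bigr (fun i => if i \in s then F i else 0)%N); last first.
  by move=> i _; case: (i \in s); rewrite ?mul1n.
rewrite -big_mkcond -big_filter; apply: perm_big; apply: uniq_perm => //.
  by rewrite filter_uniq ?iota_uniq.
move=> i; rewrite mem_filter mem_index_iota /=.
by case E: (i \in s) => //=; rewrite hs.
Qed.

(** The indicator of [s] is a Lucas decomposition of the sum, so by uniqueness it agrees with
    [lucas_digit]. *)
Lemma lucas_digit_sum_seq (s : seq nat) : uniq s ->
  lucas_admissible (fun i => i \in s) ->
  lucas_digit_sum (\sum_(i <- s) lucas i) = size s.
Proof.
move=> us adm; set n := \sum_(i <- s) lucas i.
have dn : lucas_decomposition n (fun i => i \in s).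
  split=> //; exists (\max_(i <- s) i).+1; split=> [i|].
    by apply: contraTF => si; rewrite -ltnNge ltnS leq_bigmax_seq.
  by rewrite sum_mem_seq // => i si; rewrite ltnS leq_bigmax_seq.
have E := lucas_decomposition_unique (lucas_digitP n) dn.
rewrite -sum1_size -(@sum_mem_seq s (fun=> 1) n.+1) //.
  by apply: eq_bigr => i _; rewrite E muln1.
(* The range of [lucas_digit_sum] covers [s], since digits of index above [n] vanish. *)
by move=> i si; rewrite ltnS leqNgt; apply/negP => /lucas_digit_gt; rewrite E si.
Qed.

Lemma unbounded_infinite_nat (A : set nat) :
  (forall N, exists2 n, (N < n)%N & A n) -> infinite_set A.
Proof.
move=> hA /finite_seqP[s Es].
have [n ltn An] := hA (\max_(i <- s) i).
have : (n <= \max_(i <- s) i)%N by apply: leq_bigmax_seq => //; rewrite Es in An.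
by rewrite leqNgt ltn.
Qed.

Theorem theorem3p4 (a d : nat) (ha : (0 < a)%N) (hd : (0 < d)%N) :
  infinite_set [set n : nat | (exists k : nat, n = (a + k * d)%N) /\ lucas_niven n].
Proof.
apply: unbounded_infinite_nat => N.
have [|P P0 per] := @lucas_periodic (a * d); first by rewrite muln_gt0 ha.
have per1 k : lucas (1 + k * P) = 1 %[mod a * d].
  by elim: k => [//|k IH]; rewrite mulSn addnCA addnC per.
(* Indices are 1 modulo [P], so [per1] applies. The doubling keeps them at least 2 apart even if
   [P = 1]; the shift by [N] makes the sum exceed [N] and keeps 0 out of [s]. *)
pose idx j := (1 + (N + j).+1.*2 * P)%N.
have idx_gt j : (N + 2 < idx j)%N by rewrite /idx; nia.
have idx_gap i j : (i < j)%N -> (idx i + 2 <= idx j)%N by rewrite /idx; nia.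
have idx_inj : injective idx.
  by move=> i j; case: (ltngtP i j) => // /idx_gap; lia.
pose s := [seq idx j | j <- iota 0 a].
have us : uniq s by rewrite map_inj_uniq ?iota_uniq.
have adm : lucas_admissible (fun i => i \in s).
  split=> [i|]; apply/negP => /andP[/mapP[j _ Ej] /mapP[k _ Ek]].
    by case: (ltngtP j k) => [/idx_gap|/idx_gap|Ejk]; subst; lia.
  by have := idx_gt j; rewrite -Ej.
have ssz : size s = a by rewrite size_map size_iota.
have sum_mod : (\sum_(i <- s) lucas i = a %[mod a * d])%N.
  rewrite big_map -modn_summ (eq_bigr (fun=> 1 %% (a * d))%N) => [|j _].
    by rewrite modn_summ sum1_size size_iota.
  exact: per1.
(* This bound turns the congruence into an equation with a natural quotient [q]. *)
have le_a : (a <= \sum_(i <- s) lucas i)%N.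
  by rewrite -[X in (X <= _)%N]ssz -sum1_size leq_sum // => i _; exact: lucas_gt0.
have gtN : (N < \sum_(i <- s) lucas i)%N.
  rewrite /s big_map -(prednK ha) big_cons.
  by apply/ltn_addr/(leq_trans _ (leq_lucas _)); have := idx_gt 0; lia.
exists (\sum_(i <- s) lucas i) => //=.
move/eqP: sum_mod; rewrite eqn_mod_dvd // => /dvdnP[q Eq].
have {Eq} En : (\sum_(i <- s) lucas i = a + q * (a * d))%N by rewrite -Eq subnKC.
(* The summand [q * (a * d)] is both a multiple of [d], which gives membership in the progression,
   and a multiple of the digit sum [a]. *)
split; first by exists (q * a)%N; rewrite En mulnA.
rewrite /lucas_niven lucas_digit_sum_seq // ssz (leq_ltn_trans _ gtN) //=.
by rewrite En dvdn_add // mulnCA dvdn_mulr.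
Qed.
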